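(* Let $X$ and $Y$ be Tychonoff spaces such that $C(X)$ is isomorphic with $C(Y)$ as rings. Let $\mathcal{P}\subseteq\mathcal{M}(X)$ be an algebraic set of maximal ideals of $C(X)$, and let $\mathcal{Q}\subseteq\mathcal{M}(Y)$ be its conjugate in $C(Y)$. If $X$ is locally-$\mathcal{P}$ and $\mathcal{P}$-compact, and $Y$ is locally-$\mathcal{Q}$ and $\mathcal{Q}$-compact, then $X$ is homeomorphic with $Y$.
   Context: For a space $X$, $C(X)$ is the ring of real-valued continuous functions on $X$, $C^*(X)$ is its subring of bounded functions, and $\mathcal{M}(X)$ is the set of all maximal ideals of $C(X)$. An intermediate subring $A(X)$ of $C(X)$ is a subring with $C^*(X)\subseteq A(X)\subseteq C(X)$; $\mathcal{M}(A)$ is the set of all maximal ideals of $A(X)$. Isomorphism means ring isomorphism. Conjugates and algebraic sets. For a ring isomorphism $\sigma:A(X)\to B(Y)$ between intermediate subrings of $C(X)$ and $C(Y)$ and $\mathcal{E}\subseteq\mathcal{M}(A)$, put $\sigma^*(\mathcal{E})=\{\sigma(M):M\in\mathcal{E}\}\subseteq\mathcal{M}(B)$. A set $\mathcal{Q}\subseteq\mathcal{M}(B)$ is conjugate of $\mathcal{P}\subseteq\mathcal{M}(A)$ if $\sigma^*(\mathcal{P})=\mathcal{Q}$ for every isomorphism $\sigma:A(X)\to B(Y)$. A set $\mathcal{P}\subseteq\mathcal{M}(A)$ is algebraic if, for every Tychonoff space $Y$ and every intermediate subring $B(Y)$ of $C(Y)$ isomorphic with $A(X)$, there exists $\mathcal{Q}\subseteq\mathcal{M}(B)$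 which is conjugate of $\mathcal{P}$. (When $A(X)$ and $B(Y)$ are isomorphic, the conjugate is unique.) Here these notions are used with $A(X)=C(X)$ and $B(Y)=C(Y)$. For $x\in X$ let $M_x=\{f\in C(X): f(x)=0\}$; a maximal ideal of $C(X)$ is fixed if it equals $M_x$ for some $x\in X$. For $\mathcal{P}\subseteq\mathcal{M}(X)$: $X$ is $\mathcal{P}$-compact if every $M\in\mathcal{P}$ is fixed; $X$ is locally-$\mathcal{P}$ if $M_x\in\mathcal{P}$ for every $x\in X$. The same definitions apply to $Y$ and subsets of $\mathcal{M}(Y)$. *)

(* Defs.v *)
From HB Require Import structures.
From mathcomp Require Import all_boot all_order all_algebra.
From mathcomp Require Import all_classical all_reals all_analysis.

Set Implicit Arguments.
Unset Strict Implicit.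
Unset Printing Implicit Defensive.

Import Order.TTheory GRing.Theory Num.Theory.
Import numFieldNormedType.Exports.

Local Open Scope classical_set_scope.
Local Open Scope ring_scope.

(** The ring [C(X)] is [continuousType X R], with the pointwise operations
    inherited from [X -> R].  It is only a [comPzRingType]: for empty [X] it is
    the zero ring. *)
Section continuous_functions_ring.
Context (X : topologicalType) (R : realType).

Definition cont_pred : {pred X -> R} := mem [set f : X -> R | continuous f].

Let cont_Sub (f : X -> R) (fP : f \in cont_pred) : continuousType X R :=
  mkcts (set_mem fP).

Let cont_rect (K : continuousType X R -> Type) :
  (forall f (fP : f \in cont_pred), K (cont_Sub fP)) -> forall u, K u.
Proof.
move=> Ksub u.
have uP : (u : X -> R) \in cont_pred by apply/mem_set; exact: cts_fun.
suff <- : cont_Sub uP = u by exact: Ksub.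
by apply/continuousEP.
Qed.

Let cont_valK f (fP : f \in cont_pred) : cont_Sub fP = f :> (X -> R).
Proof. by []. Qed.

HB.instance Definition _ :=
  isSub.Build (X -> R) cont_pred (continuousType X R) cont_rect cont_valK.

Lemma cont_subring_closed : subring_closed cont_pred.
Proof.
split=> [|f g /set_mem cf /set_mem cg|f g /set_mem cf /set_mem cg];
  apply/mem_set => x.
- exact: cvg_cst.
- by apply: cvgB; [exact: cf|exact: cg].
- by apply: cvgM; [exact: cf|exact: cg].
Qed.

HB.instance Definition _ :=
  GRing.isSubringClosed.Build (X -> R) cont_pred cont_subring_closed.
HB.instance Definition _ :=
  GRing.SubChoice_isSubComPzRing.Build (X -> R) cont_pred (continuousType X R)
    cont_subring_closed.

End continuous_functions_ring.

(** Subrings are subsets [A] of an ambient ring [T]; ideals of [A] are subsets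
    of [T] contained in [A].  The full ring is [A = setT]. *)
Section subrings.
Context (T : comPzRingType).

Definition is_ideal (A I : set T) : Prop :=
  [/\ I `<=` A, I 0,
      (forall f g, I f -> I g -> I (f + g)) &
      (forall a f, A a -> I f -> I (a * f))].

Definition maximal_ideals (A : set T) : set (set T) :=
  [set M | [/\ is_ideal A M, M <> A &
               forall I, is_ideal A I -> M `<=` I -> I = M \/ I = A]].

End subrings.

(** Ring isomorphisms [A -> B] are represented by maps between the ambient
    rings, of which only the values on [A] matter. *)
Section isomorphisms.
Context (T U : comPzRingType).

Definition ring_iso (A : set T) (B : set U) (s : T -> U) : Prop :=
  [/\ set_bij A B s, s 1 = 1,
      {in A &, {morph s : f g / f + g}} &
      {in A &, {morph s : f g / f * g}}].

Definition isomorphic (A : set T) (B : set U) : Prop :=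
  exists s, ring_iso A B s.

Definition ideal_image (s : T -> U) (E : set (set T)) : set (set U) :=
  [set s @` M | M in E].

Definition is_conjugate (A : set T) (B : set U)
    (P : set (set T)) (Q : set (set U)) : Prop :=
  forall s, ring_iso A B s -> ideal_image s P = Q.

End isomorphisms.

(** [completely_regular_space] is stated in the library with uniform
    separators; [uniform_separatorP] turns these into separating continuous
    functions with values in [`[0, 1]]. *)
Definition tychonoff_space (X : topologicalType) : Prop :=
  hausdorff_space X /\ completely_regular_space X.

Definition homeomorphic (X Y : topologicalType) : Prop :=
  exists (f : X -> Y) (g : Y -> X),
    [/\ continuous f, continuous g, cancel f g & cancel g f].

Definition intermediate_subring (R : realType) (X : topologicalType)
    (A : set (continuousType X R)) : Prop :=
  subring_closed [pred f | f \in A] /\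
  [set f : continuousType X R | bounded_fun (f : X -> R)] `<=` A.

Section function_rings.
Context (R : realType) (X : topologicalType).

Definition algebraic (A : set (continuousType X R))
    (P : set (set (continuousType X R))) : Prop :=
  forall (Y : topologicalType) (B : set (continuousType Y R)),
    tychonoff_space Y -> intermediate_subring B -> isomorphic A B ->
    exists2 Q, Q `<=` maximal_ideals B & is_conjugate A B P Q.

Definition point_ideal (x : X) : set (continuousType X R) :=
  [set f | f x = 0].

Definition fixed_ideal (M : set (continuousType X R)) : Prop :=
  exists x, M = point_ideal x.

Definition compact_wrt (P : set (set (continuousType X R))) : Prop :=
  forall M, P M -> fixed_ideal M.

Definition locally_wrt (P : set (set (continuousType X R))) : Prop :=
  forall x, P (point_ideal x).

End function_rings.

(* Main.v *)
Require Import Defs.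
From mathcomp Require Import all_boot all_order all_algebra.
From mathcomp Require Import all_classical all_reals all_analysis.
Import numFieldNormedType.Exports.

(** For an isomorphism [s : C(X) -> C(Y)], the hypotheses make [M |-> s(M)] a
    bijection between the fixed maximal ideals of [C(X)] and those of [C(Y)].
    It induces a bijection [f : X -> Y] with [u x = 0 <-> s u (f x) = 0], that
    is, a bijection matching zero sets of continuous functions; in a completely
    regular space these form a base of closed sets, so [f] and its inverse are
    continuous. *)

Local Open Scope classical_set_scope.

Import GRing.Theory.

(** A separator [f] is 0 at [a] and 1 off an open [V] inside [U]; passing to [1 - f] puts the cozero
    set inside [U]. *)
Lemma completely_regular_separate (R : realType) (X : topologicalType)
    (a : X) (U : set X) :
  completely_regular_space X -> nbhs a U ->
  exists f : continuousType X R, f a <> 0%R /\ forall x, f x <> 0%R -> U x.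
Proof.
move=> crX; rewrite nbhsE => -[V [oV Va] VU].
have nVa : ~ (~` V) a by apply.
have clV : closed (~` V) by exact: open_closedC.
have [f [cf _ fa fV]] := (@uniform_separatorP _ R _ _).1 (crX _ _ clV nVa).
have cg : continuous (fun x => 1 - f x : R)%R.
  by move=> x; apply: cvgB; [exact: cvg_cst|exact: cf].
exists (mkcts cg : continuousType X R); split=> [|x] /=; rewrite /mkcts.
  have -> : f a = 0%R by apply: fa; exists a.
  by rewrite subr0; apply/eqP; exact: oner_neq0.
move=> gx; apply: VU; apply: contrapT => nVx; apply: gx.
have -> : f x = 1%R by apply: fV; exists x.
by rewrite subrr.
Qed.

(** Cozero sets form a base of [Y], and the preimage under [f] of the cozero set of [v] is that of
    [u], which is open. *)
Lemma continuous_of_zero_sets (R : realType) (X Y : topologicalType)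
    (f : X -> Y) :
  completely_regular_space Y ->
  (forall v : continuousType Y R, exists u : continuousType X R,
    forall x, v (f x) = 0%R <-> u x = 0%R) ->
  continuous f.
Proof.
move=> crY pull x U Ufx.
have [v [vfx vU]] := @completely_regular_separate R Y (f x) U crY Ufx.
have [u uv] := pull v.
have ux : u x <> 0%R by move/uv.
have : nbhs x (u @^-1` [set r | r != 0%R]).
  apply: (@cts_fun _ _ u x).
  by apply: open_nbhs_nbhs; split; [exact: open_neq|exact/eqP].
apply: filterS => z /= /eqP uz.
by apply: vU => /uv.
Qed.

(** Points are closed, so for [x] distinct from [y] some function vanishes at [y] but not at [x]. *)
Lemma point_ideal_inj (R : realType) (X : topologicalType) :
  tychonoff_space X -> injective (@point_ideal R X).
Proof.
move=> [hX crX] x y Mxy; apply: contrapT => nxy.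
have Ux : nbhs x (~` [set y]).
  apply: open_nbhs_nbhs; split=> //; rewrite openC.
  exact/accessible_closed_set1/hausdorff_accessible.
have [u [ux uU]] := @completely_regular_separate R X x _ crX Ux.
apply: ux; suff : point_ideal x u by [].
by rewrite Mxy; apply: contrapT => /uU; apply.
Qed.

Lemma image_point_idealP (R : realType) (X Y : topologicalType)
    (s : continuousType X R -> continuousType Y R) (x : X) (y : Y) :
  injective s -> s @` point_ideal x = point_ideal y ->
  forall u, s u y = 0%R <-> u x = 0%R.
Proof.
move=> sI sMx u; split=> [suy|ux].
- have : point_ideal y (s u) by [].
  by rewrite -sMx => -[w wx /sI <-].
- suff : point_ideal y (s u) by [].
  by rewrite -sMx; exists u.
Qed.

Theorem theorem3p8 (R : realType) (X Y : topologicalType)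
  (P : set (set (continuousType X R))) (Q : set (set (continuousType Y R))) :
  tychonoff_space X -> tychonoff_space Y ->
  isomorphic [set: continuousType X R] [set: continuousType Y R] ->
  P `<=` maximal_ideals [set: continuousType X R] ->
  algebraic [set: continuousType X R] P ->
  Q `<=` maximal_ideals [set: continuousType Y R] ->
  is_conjugate [set: continuousType X R] [set: continuousType Y R] P Q ->
  locally_wrt P -> compact_wrt P ->
  locally_wrt Q -> compact_wrt Q ->
  homeomorphic X Y.
Proof.
move=> tX tY [s siso] _ _ _ PQ locP cptP locQ cptQ.
have sPQ := PQ s siso.
have [[_ sI sS] _ _ _] := siso.
have {}sI : injective s by move=> u v; apply: sI; rewrite in_setT.
(* $M_x\in P$, so $s(M_x)\in s^*(P)=Q$ is fixed. *)
have /choice[f fE] : forall x, exists y, s @` point_ideal x = point_ideal y.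
  by move=> x; apply: cptQ; rewrite -sPQ; exists (point_ideal x).
(* Conversely $M_y\in Q=s^*(P)$ is $s(M)$ for some $M\in P$, and this $M$ is fixed. Working with
   images under [s] avoids the inverse isomorphism. *)
have /choice[g gE] : forall y, exists x, s @` point_ideal x = point_ideal y.
  move=> y; have := locQ y; rewrite -sPQ => -[M PM sM].
  by have [x Mx] := cptP _ PM; exists x; rewrite -Mx.
have fz x u := image_point_idealP R X Y s x (f x) sI (fE x) u.
have gz y u := image_point_idealP R X Y s (g y) y sI (gE y) u.
exists f, g; split.
- apply: (continuous_of_zero_sets R) tY.2 _ => v.
  (* Surjectivity of [s] gives [v = s u], which vanishes at [f x] exactly when [u] vanishes at
     [x]. *)
  by have [u _ <-] := sS v I; exists u => x; exact: fz.
- apply: (continuous_of_zero_sets R) tX.2 _ => u.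
  by exists (s u) => y; apply: iff_sym; exact: gz.
(* Vanishing of [u] at [g (f x)] and at [x] are both equivalent to vanishing of [s u] at [f x]. *)
- move=> x; apply: (point_ideal_inj R X tX); apply/seteqP.
  by split=> u; [move=> /gz/fz|move=> /fz/gz].
- by move=> y; apply: (point_ideal_inj R Y tY); rewrite -fE gE.
Qed.
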